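(* Let $(X,f_{1,\infty})$ be a nonautonomous dynamical system, and let $K$ be a nonempty subset of $X$. If the sequence $f_{1,\infty}$ has period $k$, then $$\overline{D}_K(f_{1,\infty}^k)=\overline{D}_K(f_{1,\infty})\ge\underline{D}_K(f_{1,\infty}^k)=\underline{D}_K(f_{1,\infty}).$$
   Context: A nonautonomous dynamical system $(X,f_{1,\infty})$ consists of a compact topological space $X$ and a sequence $f_{1,\infty}=(f_i)_{i\ge 1}$ of continuous maps $f_i:X\to X$. Put $f_i^0=\mathrm{id}_X$ and $f_i^j=f_{i+j-1}\circ\cdots\circ f_{i+1}\circ f_i$. For an integer $k\ge1$, $f_{1,\infty}^k$ denotes the sequence of maps $(f_1^k,f_{k+1}^k,f_{2k+1}^k,\dots)$. The sequence $f_{1,\infty}$ has period $k$ if $f_{1,\infty}=(f_1,\dots,f_k,f_1,\dots,f_k,\dots)$, i.e. $f_{i+k}=f_i$ for all $i\ge1$. Upper and lower topological entropy dimension of a sequence $g_{1,\infty}=(g_i)_{i\ge1}$ of continuous selfmaps of $X$ on nonempty $K\subseteq X$ (applied above to $g_{1,\infty}=f_{1,\infty}$ and $f_{1,\infty}^k$). Put $g_1^0=\mathrm{id}_X$, $g_1^j=g_j\circ\cdots\circ g_1$. For a finite open cover $\mathcal{U}$ of $X$ let $\mathcal{U}_1^n$ be the cover of all sets $\bigcap_{j=0}^{n-1}(g_1^j)^{-1}(U_j)$ with $U_j\in\mathcal{U}$, and let $\mathcal{N}(\mathcal{U}_1^n|_K)$ be the minimal number of members of $\{V\cap K: V\in\mathcal{U}_1^n\}$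 needed to cover $K$. For $s>0$ set $\overline{h}_K(g_{1,\infty},s)=\sup_{\mathcal{U}}\limsup_{n\to\infty}\frac{1}{n^s}\log\mathcal{N}(\mathcal{U}_1^n|_K)$ and $\underline{h}_K(g_{1,\infty},s)=\sup_{\mathcal{U}}\liminf_{n\to\infty}\frac{1}{n^s}\log\mathcal{N}(\mathcal{U}_1^n|_K)$, suprema over all finite open covers of $X$. Then $\overline{D}_K(g_{1,\infty})=\inf\{s>0:\overline{h}_K(g_{1,\infty},s)=0\}=\sup\{s>0:\overline{h}_K(g_{1,\infty},s)=\infty\}$ and $\underline{D}_K(g_{1,\infty})=\inf\{s>0:\underline{h}_K(g_{1,\infty},s)=0\}=\sup\{s>0:\underline{h}_K(g_{1,\infty},s)=\infty\}$, with $\inf\emptyset=+\infty$ and $\sup\emptyset=0$. *)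

(* Defs.v *)
From HB Require Import structures.
From mathcomp Require Import all_boot all_order all_algebra.
From mathcomp Require Import all_classical all_reals all_analysis.

Set Implicit Arguments.
Unset Strict Implicit.
Unset Printing Implicit Defensive.

Import Order.TTheory GRing.Theory Num.Theory.
Import numFieldNormedType.Exports.

Local Open Scope classical_set_scope.
Local Open Scope ring_scope.

(* Sequences of maps are indexed from 0: [f i] stands for the map f_{i+1}, and
   [compn f i j] for f_{i+1}^j = f_{i+j} o ... o f_{i+1}. *)
Fixpoint compn (X : Type) (f : nat -> X -> X) (i j : nat) : X -> X :=
  if j is j'.+1 then f (i + j')%N \o compn f i j' else id.

Definition powseq (X : Type) (f : nat -> X -> X) (k : nat) : nat -> X -> X :=
  fun i => compn f (i * k) k.

Definition has_period (X : Type) (f : nat -> X -> X) (k : nat) : Prop :=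
  (0 < k)%N /\ forall i : nat, f (i + k)%N = f i.

Definition finite_open_cover (X : topologicalType) (U : set (set X)) : Prop :=
  [/\ finite_set U, (forall V, U V -> open V) & \bigcup_(V in U) V = setT].

Definition iter_cover (X : Type) (g : nat -> X -> X) (U : set (set X))
    (n : nat) : set (set X) :=
  [set V | exists2 c : nat -> set X, (forall j, (j < n)%N -> U (c j)) &
           V = \bigcap_(j in `I_n) (compn g 0 j @^-1` c j)].

Definition covered_by_card (X : Type) (K : set X) (W : set (set X))
    (m : nat) : Prop :=
  exists S : set (set X),
    [/\ S `<=` [set V `&` K | V in W], (S #= `I_m)%card & K `<=` \bigcup_(A in S) A].

(* The default 0 is only reached when no finite subfamily of traces covers K,
   which does not happen for the covers [iter_cover g U n], U a finite cover. *)
Definition cover_number (X : Type) (K : set X) (W : set (set X)) : nat :=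
  xget 0%N [set m | covered_by_card K W m /\
                    forall p, covered_by_card K W p -> (m <= p)%N].

(* The value at n = 0 is junk, and irrelevant for the limits. *)
Definition entropy_rate (R : realType) (X : Type) (K : set X)
    (g : nat -> X -> X) (s : R) (U : set (set X)) (n : nat) : \bar R :=
  ((n%:R `^ s)^-1 * ln (cover_number K (iter_cover g U n))%:R)%:E.

Definition upper_entropy (R : realType) (X : topologicalType) (K : set X)
    (g : nat -> X -> X) (s : R) : \bar R :=
  ereal_sup [set limn_esup (entropy_rate K g s U) | U in @finite_open_cover X].

Definition lower_entropy (R : realType) (X : topologicalType) (K : set X)
    (g : nat -> X -> X) (s : R) : \bar R :=
  ereal_sup [set limn_einf (entropy_rate K g s U) | U in @finite_open_cover X].

Definition upper_entropy_dim (R : realType) (X : topologicalType) (K : set X)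
    (g : nat -> X -> X) : \bar R :=
  ereal_inf [set s%:E | s in [set s : R | 0 < s /\ upper_entropy K g s = 0%E]].

Definition lower_entropy_dim (R : realType) (X : topologicalType) (K : set X)
    (g : nat -> X -> X) : \bar R :=
  ereal_inf [set s%:E | s in [set s : R | 0 < s /\ lower_entropy K g s = 0%E]].

(* In the definition of the entropy dimensions, the infimum is also the supremum
   of the exponents at which the entropy is infinite. *)

Lemma entropy_rate_ge0 (R : realType) (X : Type) (K : set X)
    (g : nat -> X -> X) (s : R) (U : set (set X)) (n : nat) :
  (0 <= entropy_rate K g s U n)%E.
Proof.
rewrite lee_fin mulr_ge0 ?invr_ge0 ?powR_ge0//.
by case: cover_number => [|m]; [rewrite ln0|rewrite ln_ge0 ?ler1n].
Qed.

Lemma entropy_rate_small (R : realType) (X : Type) (K : set X)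
    (g : nat -> X -> X) (s t : R) (U : set (set X)) (c e : R) :
  s < t -> 0 < e -> exists N : nat, forall n, (N <= n)%N ->
    (entropy_rate K g s U n <= c%:E -> entropy_rate K g t U n <= e%:E)%E.
Proof.
move=> st e0; pose d := Num.max c 1 / e.
have d0 : 0 < d by rewrite divr_gt0// lt_max ltr01 orbT.
have [N hN] : exists N : nat, d `^ (t - s)^-1 <= N%:R.
  by exists (Num.bound (d `^ (t - s)^-1)); rewrite ltW// archi_boundP// powR_ge0.
exists (maxn N 1) => n; rewrite geq_max => /andP[Nn n0].
have n0' : (0 : R) < n%:R by rewrite ltr0n.
have dn : d <= n%:R `^ (t - s).
  have ts : 0 < t - s by rewrite subr_gt0.
  have -> : d = (d `^ (t - s)^-1) `^ (t - s).
    by rewrite -powRrM mulVf ?gt_eqF// powRr1// ltW.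
  apply: (@ge0_ler_powR _ _ (ltW ts)); rewrite ?nnegrE ?powR_ge0 ?(ltW n0')//.
  by rewrite (le_trans hN)// ler_nat.
rewrite !lee_fin; set a := ln _ => ha.
have -> : t = s + (t - s) by rewrite subrKC.
rewrite powRD; last by rewrite (gt_eqF n0') implybT.
rewrite invfM mulrAC ler_pdivrMr ?powR_gt0//.
apply: (le_trans ha); apply: (@le_trans _ _ (e * d)); last by rewrite ler_pM2l.
by rewrite /d mulrC divfK ?gt_eqF// le_max lexx.
Qed.

Lemma limn_esup_ltP (R : realType) (u : nat -> \bar R) (c : \bar R) :
  (limn_esup u < c)%E -> exists N, forall n, (N <= n)%N -> (u n < c)%E.
Proof.
rewrite limn_esup_lim (cvg_lim _ (@cvg_esups_inf _ u))//.
move=> /ereal_inf_lt[_ [N _ <-]] h; exists N => n Nn.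
by apply: le_lt_trans h; apply: ereal_sup_ubound; exists n.
Qed.

Lemma limn_einf_ltP (R : realType) (u : nat -> \bar R) (c : \bar R) :
  (limn_einf u < c)%E -> forall N, exists2 n, (N <= n)%N & (u n < c)%E.
Proof.
rewrite limn_einf_lim (cvg_lim _ (@cvg_einfs_sup _ u))// => h N.
have /ereal_inf_lt[_ [n Nn <-] unc] : (einfs u N < c)%E.
  by apply: le_lt_trans h; apply: ereal_sup_ubound; exists N.
by exists n.
Qed.

Lemma limn_esup_le_eventually (R : realType) (u : nat -> \bar R) (c : \bar R)
    (N : nat) :
  (forall n, (N <= n)%N -> (u n <= c)%E) -> (limn_esup u <= c)%E.
Proof.
move=> h; rewrite limn_esup_lim (cvg_lim _ (@cvg_esups_inf _ u))//.
apply: (@le_trans _ _ (esups u N)); first by apply: ereal_inf_lbound; exists N.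
by apply: ge_ereal_sup => _ [n Nn <-]; exact: h.
Qed.

Lemma limn_einf_le_frequently (R : realType) (u : nat -> \bar R)
    (c : \bar R) :
  (forall N, exists2 n, (N <= n)%N & (u n <= c)%E) -> (limn_einf u <= c)%E.
Proof.
move=> h; rewrite limn_einf_lim (cvg_lim _ (@cvg_einfs_sup _ u))//.
apply: ge_ereal_sup => _ [N _ <-]; have [n Nn unc] := h N.
by apply: le_trans unc; apply: ereal_inf_lbound; exists n.
Qed.

Lemma upper_entropy_ge0 (R : realType) (X : topologicalType) (K : set X)
    (g : nat -> X -> X) (s : R) : (0 <= upper_entropy K g s)%E.
Proof.
apply: (@le_trans _ _ (limn_esup (entropy_rate K g s [set setT]))).
  by apply: limf_esup_ge0; [exact: filter_not_empty|exact: entropy_rate_ge0].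
apply: ereal_sup_ubound; exists [set setT] => //; split.
- exact: finite_set1.
- by move=> _ ->; exact: openT.
- by rewrite bigcup_set1.
Qed.

Lemma lower_entropy_ge0 (R : realType) (X : topologicalType) (K : set X)
    (g : nat -> X -> X) (s : R) : (0 <= lower_entropy K g s)%E.
Proof.
apply: (@le_trans _ _ (limn_einf (entropy_rate K g s [set setT]))).
  rewrite leNgt; apply/negP => /limn_einf_ltP /(_ 0%N) [n _].
  by rewrite ltNge entropy_rate_ge0.
apply: ereal_sup_ubound; exists [set setT] => //; split.
- exact: finite_set1.
- by move=> _ ->; exact: openT.
- by rewrite bigcup_set1.
Qed.

Lemma upper_entropy_eq0 (R : realType) (X : topologicalType) (K : set X)
    (g : nat -> X -> X) (s t : R) :
  s < t -> (upper_entropy K g s < +oo)%E -> upper_entropy K g t = 0%E.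
Proof.
move=> st hs; apply/eqP; rewrite eq_le upper_entropy_ge0 andbT.
apply: ge_ereal_sup => _ [U oU <-]; apply/lee_addgt0Pr => e e0; rewrite add0e.
have [c hc] : exists c : R, (limn_esup (entropy_rate K g s U) < c%:E)%E.
  have : (limn_esup (entropy_rate K g s U) < +oo)%E.
    by apply: le_lt_trans hs; apply: ereal_sup_ubound; exists U.
  case: limn_esup => [r _||]//; last by exists 0; rewrite ltNyr.
  by exists (r + 1); rewrite lte_fin ltrDl.
have [N hN] := limn_esup_ltP hc.
have [M hM] := @entropy_rate_small R X K g s t U c e st e0.
apply: (@limn_esup_le_eventually _ _ _ (maxn N M)) => n.
by rewrite geq_max => /andP[Nn Mn]; apply: hM => //; exact/ltW/hN.
Qed.

Lemma lower_entropy_eq0 (R : realType) (X : topologicalType) (K : set X)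
    (g : nat -> X -> X) (s t : R) :
  s < t -> (lower_entropy K g s < +oo)%E -> lower_entropy K g t = 0%E.
Proof.
move=> st hs; apply/eqP; rewrite eq_le lower_entropy_ge0 andbT.
apply: ge_ereal_sup => _ [U oU <-]; apply/lee_addgt0Pr => e e0; rewrite add0e.
have [c hc] : exists c : R, (limn_einf (entropy_rate K g s U) < c%:E)%E.
  have : (limn_einf (entropy_rate K g s U) < +oo)%E.
    by apply: le_lt_trans hs; apply: ereal_sup_ubound; exists U.
  case: limn_einf => [r _||]//; last by exists 0; rewrite ltNyr.
  by exists (r + 1); rewrite lte_fin ltrDl.
have [M hM] := @entropy_rate_small R X K g s t U c e st e0.
apply: limn_einf_le_frequently => N.
have [n] := limn_einf_ltP hc (maxn N M).
by rewrite geq_max => /andP[Nn Mn] /ltW uc; exists n => //; exact: hM.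
Qed.

Lemma ereal_inf_critical (R : realType) (h : R -> \bar R) :
  (forall s t, s < t -> (h s < +oo)%E -> h t = 0%E) ->
  ereal_inf [set s%:E | s in [set s | 0 < s /\ h s = 0%E]] =
  maxe 0%E (ereal_sup [set s%:E | s in [set s | 0 < s /\ h s = +oo%E]]).
Proof.
move=> h0; apply/eqP; rewrite eq_le; apply/andP; split; last first.
  rewrite ge_max; apply/andP; split.
    by apply: le_ereal_inf_tmp => _ [s [s0 _] <-]; rewrite lee_fin ltW.
  apply: ge_ereal_sup => _ [s [s0 hs] <-].
  apply: le_ereal_inf_tmp => _ [t [t0 ht] <-].
  rewrite lee_fin leNgt; apply/negP => ts.
  by have := h0 _ _ ts; rewrite ht hs => /(_ (ltry _)).
set S := ereal_sup _; set I := ereal_inf _.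
have [/eqP ->|Sy] := boolP (maxe 0%E S == +oo%E); first exact: leey.
have [a Sa] : exists a : R, maxe 0%E S = a%:E.
  have : (0 <= maxe 0%E S)%E by rewrite le_max lexx.
  by case: (maxe 0%E S) Sy => [a _ _||]//; exists a.
rewrite Sa; apply/lee_addgt0Pr => e e0.
have a0 : 0 <= a by rewrite -lee_fin -Sa le_max lexx.
apply: ereal_inf_lbound; exists (a + e) => //; split; first by rewrite ltr_wpDl.
apply: (h0 (a + e / 2)); first by rewrite ltrD2l gtr_pMr// invf_lt1// ltr1n.
rewrite ltey; apply/eqP => hy.
have : (S <= a%:E)%E by rewrite -Sa le_max lexx orbT.
apply/negP; rewrite -ltNge; apply: (@lt_le_trans _ _ (a + e / 2)%:E).
  by rewrite lte_fin ltrDl divr_gt0.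
apply: ereal_sup_ubound; exists (a + e / 2) => //; split => //.
by rewrite ltr_wpDl// divr_gt0.
Qed.

Lemma upper_entropy_dimE (R : realType) (X : topologicalType) (K : set X)
    (g : nat -> X -> X) :
  upper_entropy_dim R K g =
  maxe 0%E (ereal_sup
    [set s%:E | s in [set s : R | 0 < s /\ upper_entropy K g s = +oo%E]]).
Proof. by apply: ereal_inf_critical => s t; exact: upper_entropy_eq0. Qed.

Lemma lower_entropy_dimE (R : realType) (X : topologicalType) (K : set X)
    (g : nat -> X -> X) :
  lower_entropy_dim R K g =
  maxe 0%E (ereal_sup
    [set s%:E | s in [set s : R | 0 < s /\ lower_entropy K g s = +oo%E]]).
Proof. by apply: ereal_inf_critical => s t; exact: lower_entropy_eq0. Qed.

(* Main.v *)
Require Import Defs.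
From mathcomp Require Import all_boot all_order all_algebra.
From mathcomp Require Import all_classical all_reals all_analysis.
From mathcomp Require Import zify.

(** Write g for the sequence of k-step maps of f.  Its orbit is the orbit of f
    sampled at the multiples of k, so n steps of g fit into nk steps of f, and
    nk steps of f are n blocks of k steps, each carried by one step of g.

    For covers this reads as follows.  The cover of nk steps of f built from U
    refines the cover of n steps of g built from U.  Conversely, take for V the
    cover of the first k steps of f built from U; it is a finite open cover
    because the maps are continuous.  By periodicity every block of k steps
    looks like the first one, so the cover of n steps of g built from V refines
    the cover of nk steps of f built from U.  A refinement has at least as
    large a cover number, hence, for N the cover numbers,
      N_g(U, n) <= N_f(U, nk) <= N_g(V, n).

    The times n and nk are comparable up to a constant factor, and passing from
    one to the other multiplies n^s by a bounded factor only.  Rates of order s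
    of f and g therefore dominate each other up to a constant; the intermediate
    times of f are reached by rounding down or up to a multiple of k, since N is
    monotone in time.  So for every s > 0 the entropy of order s vanishes for f
    if and only if it does for g, and the critical exponents coincide.  The
    inequality in the middle is liminf <= limsup. *)

Section PeriodicEntropyDimension.

Import Order.TTheory GRing.Theory Num.Theory.
Import numFieldNormedType.Exports.
Local Open Scope classical_set_scope.
Local Open Scope nat_scope.

(** * Iterates of a sequence of maps *)

Lemma compn_add {X : Type} (f : nat -> X -> X) (i j l : nat) :
  compn f i (j + l) = compn f (i + j) l \o compn f i j.
Proof. by elim: l => [|l IH]; rewrite ?addn0 // addnS /= IH addnA. Qed.

Lemma compn_powseq {X : Type} (f : nat -> X -> X) (k n : nat) :
  compn (powseq f k) 0 n = compn f 0 (n * k).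
Proof.
elim: n => [|n IH] //=.
by rewrite IH add0n mulSnr compn_add add0n.
Qed.

Lemma compn_period {X : Type} (f : nat -> X -> X) (k i j : nat) :
  has_period f k -> compn f (i * k) j = compn f 0 j.
Proof.
move=> [_ fk]; elim: j => [|j IH] //=; rewrite IH add0n; congr (_ \o _).
by elim: i {IH} => [|i IH] //; rewrite mulSn -addnA addnC fk.
Qed.

Lemma continuous_compn {X : topologicalType} (f : nat -> X -> X) (i j : nat) :
  (forall l, continuous (f l)) -> continuous (compn f i j).
Proof.
move=> fc; elim: j => [|j IH] /= x; first exact: cvg_id.
by apply: continuous_comp; [exact: IH | exact: fc].
Qed.

(** * Refinement and cover numbers *)

Definition refines {X : Type} (W W' : set (set X)) : Prop :=
  forall V, W V -> exists2 V', W' V' & V `<=` V'.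

(** Enlarging each member of a subcover to a member of the coarser cover may
    identify some of them, but never creates new ones. *)
Lemma covered_by_card_refines {X : Type} (K : set X) (W W' : set (set X))
    (m : nat) :
  refines W W' -> covered_by_card K W m ->
  exists2 p, p <= m & covered_by_card K W' p.
Proof.
move=> WW' [S [SW Sm KS]].
have /choice[F hF] : forall A, exists B, S A ->
    [set V `&` K | V in W'] B /\ A `<=` B.
  move=> A; have [/SW[V WV <-]|nSA] := pselect (S A); last by exists A.
  have [V' WV' VV'] := WW' V WV; exists (V' `&` K) => _; split.
    by exists V'.
  exact: setSI.
have FS : finite_set (F @` S) by apply: finite_image; exists m.
have [p Fp] := FS; exists p.
  rewrite -card_le_II -(card_le_eql Fp) -(card_le_eqr Sm).
  exact: card_image_le.
exists (F @` S); split => //.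
  by move=> _ [A SA <-]; have [] := hF A SA.
move=> x /KS[A SA Ax]; exists (F A); first by exists A.
by have [_] := hF A SA; exact.
Qed.

Lemma cover_numberP {X : Type} (K : set X) (W : set (set X)) (m : nat) :
  covered_by_card K W m ->
  covered_by_card K W (cover_number K W) /\
  forall p, covered_by_card K W p -> cover_number K W <= p.
Proof.
move=> Wm; apply: (@xgetPex _ 0 [set n | covered_by_card K W n /\
  forall p, covered_by_card K W p -> n <= p]).
have ex : exists n, `[< covered_by_card K W n >] by exists m; exact/asboolP.
case: (ex_minnP ex) => n /asboolP Wn nmin; exists n; split => // p Wp.
by apply: nmin; exact/asboolP.
Qed.

(** The finer cover must admit a finite subcover of K, so that its cover number
    is a genuine minimum and not the default value. *)
Lemma cover_number_le {X : Type} (K : set X) (W W' : set (set X)) :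
  finite_set W -> K `<=` \bigcup_(V in W) V -> refines W W' ->
  cover_number K W' <= cover_number K W.
Proof.
move=> Wfin KW WW'.
have [m Sm] : finite_set [set V `&` K | V in W] by exact: finite_image.
have Wm : covered_by_card K W m.
  exists [set V `&` K | V in W]; split => // x Kx.
  by have [V WV Vx] := KW x Kx; exists (V `&` K) => //; exists V.
have [WN _] := cover_numberP K W m Wm.
have [p pN Wp] := covered_by_card_refines K W W' _ WW' WN.
by apply: leq_trans pN; have [_] := cover_numberP K W' p Wp; exact.
Qed.

(** * Covers along orbits *)

Lemma bigcap_II_recr {X : Type} (F : nat -> set X) (n : nat) :
  \bigcap_(j in `I_n.+1) F j = \bigcap_(j in `I_n) F j `&` F n.
Proof. by rewrite IIS bigcap_setU bigcap_set1. Qed.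

Lemma iter_cover_finite {X : Type} (g : nat -> X -> X) (U : set (set X))
    (n : nat) :
  finite_set U -> finite_set (iter_cover g U n).
Proof.
move=> Ufin; elim: n => [|n IH].
  apply: (@sub_finite_set _ _ [set setT]); last exact: finite_set1.
  by move=> V [c _ ->]; rewrite II0 bigcap_set0.
apply: sub_finite_set (finite_image2
  (fun A B => A `&` compn g 0 n @^-1` B) IH Ufin) => V [c Uc ->].
exists (\bigcap_(j in `I_n) (compn g 0 j @^-1` c j)).
  by exists c => // j jn; apply: Uc; exact: ltnW.
by exists (c n); [exact: Uc | rewrite bigcap_II_recr].
Qed.

Lemma iter_cover_covers {X : Type} (g : nat -> X -> X) (U : set (set X))
    (n : nat) :
  \bigcup_(V in U) V = setT -> \bigcup_(V in iter_cover g U n) V = setT.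
Proof.
move=> UT; apply/seteqP; split => // x _.
have /choice[c hc] : forall j, exists V, U V /\ V (compn g 0 j x).
  move=> j; have : (\bigcup_(V in U) V) (compn g 0 j x) by rewrite UT.
  by case=> V UV Vx; exists V.
exists (\bigcap_(j in `I_n) (compn g 0 j @^-1` c j)).
  by exists c => // j _; have [] := hc j.
by move=> j _; have [] := hc j.
Qed.

Lemma iter_cover_open {X : topologicalType} (g : nat -> X -> X)
    (U : set (set X)) (n : nat) :
  (forall i, continuous (g i)) -> (forall V, U V -> open V) ->
  forall V, iter_cover g U n V -> open V.
Proof.
move=> gc Uo _ [c Uc ->]; elim: n Uc => [|n IH] Uc.
  by rewrite II0 bigcap_set0; exact: openT.
rewrite bigcap_II_recr; apply: openI.
  by apply: IH => j jn; apply: Uc; exact: ltnW.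
apply: open_comp; last by apply: Uo; exact: Uc.
by move=> x _; exact: continuous_compn.
Qed.

Lemma finite_open_cover_iter {X : topologicalType} (g : nat -> X -> X)
    (U : set (set X)) (n : nat) :
  (forall i, continuous (g i)) -> finite_open_cover U ->
  finite_open_cover (iter_cover g U n).
Proof.
move=> gc [Ufin Uo UT]; split.
- exact: iter_cover_finite.
- exact: iter_cover_open.
- exact: iter_cover_covers.
Qed.

Lemma cover_number_iter_le {X : topologicalType} (K : set X)
    (g g' : nat -> X -> X) (U U' : set (set X)) (n n' : nat) :
  finite_open_cover U ->
  refines (iter_cover g U n) (iter_cover g' U' n') ->
  cover_number K (iter_cover g' U' n') <= cover_number K (iter_cover g U n).
Proof.
move=> [Ufin _ UT] ref; apply: cover_number_le => //.
  exact: iter_cover_finite.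
by rewrite iter_cover_covers.
Qed.

(** Running longer along the orbit of f imposes more conditions; those at the
    multiples of k are the conditions of the k-step maps. *)
Lemma refines_powseq {X : Type} (f : nat -> X -> X) (U : set (set X))
    (k m n : nat) :
  0 < k -> n * k <= m ->
  refines (iter_cover f U m) (iter_cover (powseq f k) U n).
Proof.
move=> k0 nkm V [c Uc ->].
have lt_m j : j < n -> j * k < m.
  by move=> jn; apply: leq_trans nkm; rewrite ltn_pmul2r.
exists (\bigcap_(j in `I_n) (compn (powseq f k) 0 j @^-1` c (j * k))).
  by exists (fun j => c (j * k)) => // j /lt_m; exact: Uc.
by move=> x hx j jn; rewrite /preimage /= compn_powseq; exact/hx/lt_m.
Qed.

(** By periodicity, the position after ik+j steps is reached from the position
    after ik steps by the first j maps; hence the itinerary through U over the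
    i-th block is the one recorded by the block cover at the i-th step of the
    k-step maps. *)
Lemma powseq_refines {X : Type} (f : nat -> X -> X) (U : set (set X))
    (k m n : nat) :
  has_period f k -> m <= n * k ->
  refines (iter_cover (powseq f k) (iter_cover f U k) n) (iter_cover f U m).
Proof.
move=> fk mnk V [c Uc ->]; have [k0 _] := fk.
have /choice[d hd] : forall i, exists d : nat -> set X, i < n ->
    (forall j, j < k -> U (d j)) /\
    c i = \bigcap_(j in `I_k) (compn f 0 j @^-1` d j).
  move=> i; have [/Uc[d Ud cE]|ni] := pselect (i < n); first by exists d.
  by exists c => /ni.
have lt_n l : l < m -> l %/ k < n.
  by move=> lm; rewrite ltn_divLR//; exact: leq_trans mnk.
exists (\bigcap_(l in `I_m) (compn f 0 l @^-1` d (l %/ k) (l %% k))).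
  exists (fun l => d (l %/ k) (l %% k)) => // l /lt_n ln.
  by have [Ud _] := hd _ ln; apply: Ud; rewrite ltn_mod.
move=> x hx l /lt_n ln; have [_ cE] := hd _ ln.
have := hx _ ln; rewrite /preimage /= cE compn_powseq => /(_ (l %% k)).
rewrite /preimage /= -(compn_period f k (l %/ k) _ fk) ltn_mod => /(_ k0).
have -> // : compn f 0 l =
    compn f (l %/ k * k) (l %% k) \o compn f 0 (l %/ k * k).
by rewrite {1}(divn_eq l k) compn_add add0n.
Qed.

(** * Comparison of entropies *)

Local Open Scope ring_scope.
Local Open Scope ereal_scope.

Context {R : realType} {X : topologicalType}.
Implicit Types (K : set X) (g : nat -> X -> X) (s : R) (U : set (set X)).

Lemma entropy_rate_le K g g' s U U' (c n n' : nat) :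
  (0 <= s)%R -> (0 < n)%N -> (0 < n')%N -> (n' <= c * n)%N ->
  (cover_number K (iter_cover g U n) <=
     cover_number K (iter_cover g' U' n'))%N ->
  entropy_rate K g s U n <=
    (c%:R `^ s)%:E * entropy_rate K g' s U' n'.
Proof.
move=> s0 n0 n'0 n'c NN'; rewrite /entropy_rate -EFinM lee_fin.
set a := cover_number _ _ in NN' *; set b := cover_number _ _ in NN' *.
have lnb : (0 <= ln b%:R :> R)%R.
  by case: (b) => [|b']; [rewrite ln0 | rewrite ln_ge0 ?ler1n].
have lnab : (ln a%:R <= ln b%:R :> R)%R.
  case: (posnP a) => [->|a0]; first by rewrite ln0.
  by rewrite ler_ln ?ler_nat ?posrE ?ltr0n // (leq_trans a0).
have pn : (0 < n%:R `^ s :> R)%R by rewrite powR_gt0 ?ltr0n.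
have pn' : (0 < n'%:R `^ s :> R)%R by rewrite powR_gt0 ?ltr0n.
have pc : (n'%:R `^ s <= c%:R `^ s * n%:R `^ s :> R)%R.
  rewrite -powRM // -natrM.
  by apply: (ge0_ler_powR s0); rewrite ?nnegrE ?ler_nat.
rewrite mulrA (le_trans (ler_wpM2l _ lnab)) ?invr_ge0 ?(ltW pn) //.
apply: ler_wpM2r => //.
by rewrite ler_pdivlMr // mulrC ler_pdivrMr.
Qed.

(** The upper bound on [q n] makes [(q n)^s] at most a constant times [n^s], so
    the rate at n is at most that constant times the dominating rate at [q n];
    the lower bound sends [q n] to infinity with n. *)
Lemma upper_entropy_eq0_dominated K g g' s :
  (0 <= s)%R ->
  (forall U, finite_open_cover U ->
     exists U' (c : nat) (q : nat -> nat),
       [/\ finite_open_cover U', (0 < c)%N &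
           forall n, (c <= n)%N ->
             [/\ (n <= c * q n)%N, (q n <= c * n)%N &
                 (cover_number K (iter_cover g U n) <=
                    cover_number K (iter_cover g' U' (q n)))%N]]) ->
  upper_entropy K g' s = 0 -> upper_entropy K g s = 0.
Proof.
move=> s0 dom h0; apply/eqP; rewrite eq_le upper_entropy_ge0 andbT.
apply: ge_ereal_sup => _ [U /dom[U' [c [q [oU' c0 hq]]]] <-].
have pc : (0 < c%:R `^ s :> R)%R by rewrite powR_gt0 ?ltr0n.
apply/lee_addgt0Pr => e e0; rewrite add0e.
have : limn_esup (entropy_rate K g' s U') < (e / c%:R `^ s)%:E.
  apply: (@le_lt_trans _ _ 0); last by rewrite lte_fin divr_gt0.
  by rewrite -h0; apply: ereal_sup_ubound; exists U'.
move=> /limn_esup_ltP[N hN].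
apply: (limn_esup_le_eventually (N := maxn c (c * N))) => n.
rewrite geq_max => /andP[cn cNn]; have [nq qn NN'] := hq n cn.
have n0 : (0 < n)%N by exact: leq_trans cn.
have q0 : (0 < q n)%N by case: (q n) nq => //; rewrite muln0 leqNgt n0.
apply: (le_trans (entropy_rate_le K g g' s U U' c n _ s0 n0 q0 qn NN')).
have Nq : (N <= q n)%N by rewrite -(leq_pmul2l c0); exact: leq_trans nq.
rewrite muleC -lee_pdivlMr // -EFinM; exact/ltW/hN.
Qed.

(** For the lower limit the sampling goes in the other direction: a good time n
    for the dominating rate yields the good time [q n] for the dominated one. *)
Lemma lower_entropy_eq0_dominated K g g' s :
  (0 <= s)%R ->
  (forall U, finite_open_cover U ->
     exists U' (c : nat) (q : nat -> nat),
       [/\ finite_open_cover U', (0 < c)%N &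
           forall n, (c <= n)%N ->
             (n <= c * q n)%N /\
             (cover_number K (iter_cover g U (q n)) <=
                cover_number K (iter_cover g' U' n))%N]) ->
  lower_entropy K g' s = 0 -> lower_entropy K g s = 0.
Proof.
move=> s0 dom h0; apply/eqP; rewrite eq_le lower_entropy_ge0 andbT.
apply: ge_ereal_sup => _ [U /dom[U' [c [q [oU' c0 hq]]]] <-].
have pc : (0 < c%:R `^ s :> R)%R by rewrite powR_gt0 ?ltr0n.
apply/lee_addgt0Pr => e e0; rewrite add0e.
have : limn_einf (entropy_rate K g' s U') < (e / c%:R `^ s)%:E.
  apply: (@le_lt_trans _ _ 0); last by rewrite lte_fin divr_gt0.
  by rewrite -h0; apply: ereal_sup_ubound; exists U'.
move=> /limn_einf_ltP hN.
apply: limn_einf_le_frequently => N.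
have [n] := hN (maxn c (c * N)).
rewrite geq_max => /andP[cn cNn] hn; have [nq NN'] := hq n cn.
have n0 : (0 < n)%N by exact: leq_trans cn.
have q0 : (0 < q n)%N by case: (q n) nq => //; rewrite muln0 leqNgt n0.
exists (q n); first by rewrite -(leq_pmul2l c0); exact: leq_trans nq.
apply: (le_trans (entropy_rate_le K g g' s U U' c _ n s0 q0 n0 nq NN')).
rewrite muleC -lee_pdivlMr // -EFinM; exact/ltW.
Qed.

(** * Periodic sequences *)

Section Periodic.

Variables (f : nat -> X -> X) (K : set X) (k : nat).
Hypothesis f_continuous : forall i, continuous (f i).
Hypothesis f_period : has_period f k.

Let k_gt0 : (0 < k)%N. Proof. by case: f_period. Qed.

Lemma upper_entropy_powseq_eq0 s : (0 <= s)%R ->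
  upper_entropy K (powseq f k) s = 0 <-> upper_entropy K f s = 0.
Proof.
move=> s0; split; apply: upper_entropy_eq0_dominated => // U oU.
- (* Round n up to a whole number of blocks. *)
  exists (iter_cover f U k), (2 * k)%N, (fun n => (n %/ k).+1); split.
  + exact: finite_open_cover_iter.
  + by rewrite muln_gt0.
  move=> n kn; have nq : (n <= (n %/ k).+1 * k)%N by rewrite ltnW // ltn_ceil.
  split.
  + by apply: leq_trans nq _; rewrite mulnC leq_mul // leq_pmull.
  + apply: (@leq_trans (2 * n)); first by have := leq_div n k; lia.
    by rewrite leq_mul2r leq_pmulr // orbT.
  apply: cover_number_iter_le; last exact: powseq_refines.
  exact: finite_open_cover_iter.
- exists U, k, (fun n => n * k)%N; split => // n kn; split.
  + by rewrite mulnCA leq_pmulr // muln_gt0 k_gt0.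
  + by rewrite mulnC.
  by apply: cover_number_iter_le => //; exact: refines_powseq.
Qed.

Lemma lower_entropy_powseq_eq0 s : (0 <= s)%R ->
  lower_entropy K (powseq f k) s = 0 <-> lower_entropy K f s = 0.
Proof.
move=> s0; split; apply: lower_entropy_eq0_dominated => // U oU.
- exists (iter_cover f U k), 1%N, (fun n => n * k)%N; split => //.
    exact: finite_open_cover_iter.
  move=> n _; split; first by rewrite mul1n leq_pmulr.
  apply: cover_number_iter_le; last exact: powseq_refines.
  exact: finite_open_cover_iter.
- (* Round n down to a whole number of blocks; from n = k on there is at least
     one, so at most half of the time is lost. *)
  exists U, (2 * k)%N, (fun n => n %/ k)%N; split => //.
    by rewrite muln_gt0.
  move=> n kn; split.
    have q0 : (0 < n %/ k)%N by rewrite divn_gt0 //; lia.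
    apply: leq_trans (ltnW (ltn_ceil n k_gt0)) _.
    rewrite [(2 * k)%N]mulnC -mulnA mulnC leq_mul2l.
    by rewrite mul2n -addnn -add1n leq_add2r q0 orbT.
  apply: cover_number_iter_le => //; apply: refines_powseq => //.
  exact: leq_divM.
Qed.

Lemma upper_entropy_dim_powseq :
  upper_entropy_dim R K (powseq f k) = upper_entropy_dim R K f.
Proof.
have h0 s (s0 : (0 < s)%R) := upper_entropy_powseq_eq0 s (ltW s0).
have E : [set s : R | (0 < s)%R /\ upper_entropy K (powseq f k) s = 0] =
    [set s : R | (0 < s)%R /\ upper_entropy K f s = 0].
  apply/seteqP; split=> s [s0 hs].
    exact: conj s0 (proj1 (h0 s s0) hs).
  exact: conj s0 (proj2 (h0 s s0) hs).
exact: (congr1 (fun A : set R => ereal_inf [set s%:E | s in A]) E).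
Qed.

Lemma lower_entropy_dim_powseq :
  lower_entropy_dim R K (powseq f k) = lower_entropy_dim R K f.
Proof.
have h0 s (s0 : (0 < s)%R) := lower_entropy_powseq_eq0 s (ltW s0).
have E : [set s : R | (0 < s)%R /\ lower_entropy K (powseq f k) s = 0] =
    [set s : R | (0 < s)%R /\ lower_entropy K f s = 0].
  apply/seteqP; split=> s [s0 hs].
    exact: conj s0 (proj1 (h0 s s0) hs).
  exact: conj s0 (proj2 (h0 s s0) hs).
exact: (congr1 (fun A : set R => ereal_inf [set s%:E | s in A]) E).
Qed.

End Periodic.

Lemma lower_entropy_le_upper K g s :
  lower_entropy K g s <= upper_entropy K g s.
Proof.
apply: ge_ereal_sup => _ [U oU <-]; apply: le_trans (limn_einf_sup _) _.
by apply: ereal_sup_ubound; exists U.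
Qed.

Lemma lower_entropy_dim_le_upper K g :
  lower_entropy_dim R K g <= upper_entropy_dim R K g.
Proof.
apply: ereal_inf_le_tmp; apply: image_subset => s [s0 hs]; split => //.
by apply/eqP; rewrite eq_le lower_entropy_ge0 -hs lower_entropy_le_upper.
Qed.

End PeriodicEntropyDimension.

Local Open Scope classical_set_scope.
Local Open Scope ereal_scope.

Theorem theorem3p9 (R : realType) (X : topologicalType) (f : nat -> X -> X)
    (K : set X) (k : nat)
    (X_compact : compact [set: X])
    (f_continuous : forall i : nat, continuous (f i))
    (K_nonempty : K !=set0)
    (f_period : has_period f k) :
  [/\ upper_entropy_dim R K (powseq f k) = upper_entropy_dim R K f,
      upper_entropy_dim R K f >= lower_entropy_dim R K (powseq f k) &
      lower_entropy_dim R K (powseq f k) = lower_entropy_dim R K f].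
Proof.
split.
- exact: upper_entropy_dim_powseq.
- by rewrite lower_entropy_dim_powseq //; exact: lower_entropy_dim_le_upper.
- exact: lower_entropy_dim_powseq.
Qed.
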